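(* Let $k\ge 3$ and $\omega=\cos(2\pi/k)+\mathbf{i}\sin(2\pi/k)$. Let $M_G$ be a mixed graph and let $V(M_G)=V_1\cup V_2\cup\cdots\cup V_k$ be an admissible partition of its vertex set. If $M_G'$ is the mixed graph obtained from $M_G$ by the three-way switching with respect to this partition, then $M_G'$ is cospectral with $M_G$.
   Context: A mixed graph $M_G$ is obtained from a simple graph $G$ (its underlying graph) by leaving some edges undirected and replacing each other edge by an arc. Its Hermitian adjacency matrix $H(M_G)=(h_{uv})$ has $h_{uv}=\omega$ if there is an arc from $u$ to $v$, $h_{uv}=\overline{\omega}$ if there is an arc from $v$ to $u$, $h_{uv}=1$ if $uv$ is an undirected edge, and $0$ otherwise. Two mixed graphs are cospectral if their Hermitian adjacency matrices have the same eigenvalues with multiplicities. Given a partition $V(M_G)=V_1\cup\cdots\cup V_k$ into $k$ possibly empty sets, an arc from $x$ to $y$, or an undirected edge $\{x,y\}$, is said to be of type $(\omega^i,\omega^j)$ if $x\in V_i$ and $y\in V_j$. The partition is admissible if (i) every undirected edge is of some type $(\omega^i,\omega^j)$ with $j-i\equiv 0,1$ or $-1 \pmod k$, and (ii) every arc is of some type $(\omega^i,\omega^j)$ with $i-j\equiv 0,1$ or $2\pmod k$. The three-way switching with respect to an admissible partition changes $M_G$ into $M_G'$ (same underlying graph) by: (i) replacing each undirected edge $\{x,y\}$ of type $(\omega^i,\omega^j)$ with $j-i\equiv 1\pmod k$ by the arc from $x$ to $y$; (ii) replacing each arc of type $(\omega^i,\omega^j)$ with $i-j\equiv 1\pmod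 k$ by an undirected edge; (iii) reversing the direction of each arc of type $(\omega^i,\omega^j)$ with $i-j\equiv 2\pmod k$; all other edges and arcs are left unchanged. *)

(* Defs.v *)
From HB Require Import structures.
From mathcomp Require Import all_boot all_order all_algebra.
From mathcomp Require Import ring complex.
From mathcomp Require Import all_classical all_reals all_analysis.

Set Implicit Arguments.
Unset Strict Implicit.
Unset Printing Implicit Defensive.

Import Order.TTheory GRing.Theory Num.Theory.

Local Open Scope ring_scope.

Record simple_graph (V : finType) := SimpleGraph {
  adj : rel V;
  adj_sym : forall x y, adj x y -> adj y x;
  adj_irr : forall x, ~~ adj x x }.

Record mixed_graph (V : finType) := MixedGraph {
  underlying : simple_graph V;
  arc : rel V;
  arc_adj : forall x y, arc x y -> adj underlying x y;
  arc_asym : forall x y, arc x y -> ~~ arc y x }.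

Definition undirected (V : finType) (M : mixed_graph V) (x y : V) : bool :=
  [&& adj (underlying M) x y, ~~ arc M x y & ~~ arc M y x].

Definition omega (R : realType) (k : nat) : R[i] :=
  Complex (cos (2 * pi / k%:R)) (sin (2 * pi / k%:R)).

(* The vertex set is listed by [enum_val : 'I_#|V| -> V] to index the matrix. *)
Definition hermitian_adj (R : realType) (k : nat) (V : finType)
    (M : mixed_graph V) : 'M[R[i]]_#|V| :=
  \matrix_(a, b)
    let u := enum_val a in let v := enum_val b in
    if arc M u v then omega R k
    else if arc M v u then conjc (omega R k)
    else if undirected M u v then 1 else 0.

(* The multiplicity of an eigenvalue is its multiplicity as a root of the
   characteristic polynomial. *)
Definition cospectral (R : realType) (k : nat) (V W : finType)
    (M : mixed_graph V) (N : mixed_graph W) : Prop :=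
  let A := hermitian_adj R k M in let B := hermitian_adj R k N in
  (forall a : R[i], eigenvalue A a <-> eigenvalue B a) /\
  (forall a : R[i], eigenvalue A a ->
     mup a (char_poly A) = mup a (char_poly B)).

(* Parts are indexed by 0, ..., k-1 instead of 1, ..., k, and may be empty;
   only differences of indices modulo k are used below. *)
Definition vertex_partition (V : finType) (k : nat) (P : 'I_k -> {set V}) :
    Prop :=
  (forall x, exists i, x \in P i) /\
  (forall i j, i != j -> [disjoint P i & P j]).

Definition of_type (V : finType) (k : nat) (P : 'I_k -> {set V})
    (i j : 'I_k) (x y : V) : bool := (x \in P i) && (y \in P j).

Definition diff_mod (k : nat) (i j : 'I_k) (d : int) : Prop :=
  (i%:Z - j%:Z = d %[mod k%:Z])%Z.

Definition admissible (V : finType) (M : mixed_graph V) (k : nat)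
    (P : 'I_k -> {set V}) : Prop :=
  (forall x y, undirected M x y -> exists i j, of_type P i j x y /\
     [\/ diff_mod j i 0, diff_mod j i 1 | diff_mod j i (-1)]) /\
  (forall x y, arc M x y -> exists i j, of_type P i j x y /\
     [\/ diff_mod i j 0, diff_mod i j 1 | diff_mod i j 2]).

(* An undirected edge {x, y} is both of type (i, j), read from x to y, and of
   type (j, i), read from y to x; hence the two exclusions in [switch_und]. *)
Record three_way_switching (V : finType) (M : mixed_graph V) (k : nat)
    (P : 'I_k -> {set V}) (M' : mixed_graph V) : Prop := ThreeWaySwitching {
  switch_underlying : underlying M' = underlying M;
  switch_und_to_arc : forall i j x y, undirected M x y -> of_type P i j x y ->
    diff_mod j i 1 -> arc M' x y;
  switch_arc_to_und : forall i j x y, arc M x y -> of_type P i j x y ->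
    diff_mod i j 1 -> undirected M' x y;
  switch_reverse : forall i j x y, arc M x y -> of_type P i j x y ->
    diff_mod i j 2 -> arc M' y x;
  switch_und : forall i j x y, undirected M x y -> of_type P i j x y ->
    ~ diff_mod j i 1 -> ~ diff_mod i j 1 -> undirected M' x y;
  switch_arc : forall i j x y, arc M x y -> of_type P i j x y ->
    ~ diff_mod i j 1 -> ~ diff_mod i j 2 -> arc M' x y }.

Lemma diff_mod_absurd (k : nat) (i j : 'I_k) :
  (3 <= k)%N ->
  (diff_mod i j 1 -> ~ diff_mod i j 2) /\ (diff_mod i j 1 -> ~ diff_mod j i 1).
Proof.
move=> k3; have nd (d : nat) : (0 < d < 3)%N -> (k%:Z %| d%:Z)%Z = false.
  move=> /andP[d0 d3]; apply/negbTE/negP; rewrite dvdzE /= => /(dvdn_leq d0).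
  by rewrite leqNgt (leq_trans d3 k3).
split=> /eqP; rewrite eqz_mod_dvd => h1 /eqP; rewrite eqz_mod_dvd => h2.
- have := rpredB h1 h2.
  have -> : i%:Z - j%:Z - 1 - (i%:Z - j%:Z - 2) = 1%:Z by ring.
  by rewrite nd.
- have := rpredD h1 h2.
  have -> : i%:Z - j%:Z - 1 + (j%:Z - i%:Z - 1) = - 2%:Z by ring.
  by rewrite rpredN nd.
Qed.

Lemma three_way_switching_exists (V : finType) (M : mixed_graph V) (k : nat)
    (P : 'I_k -> {set V}) :
  (3 <= k)%N -> vertex_partition P -> exists M', three_way_switching M P M'.
Proof.
move=> k3 [cover disj].
have uniqP x i j : x \in P i -> x \in P j -> i = j.
  move=> xi xj; apply/eqP/negPn/negP => /disj /pred0P /(_ x) /=.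
  by rewrite xi xj.
have uniqT i j i' j' x y : of_type P i j x y -> of_type P i' j' x y ->
    i = i' /\ j = j'.
  by move=> /andP[h1 h2] /andP[h3 h4]; split; [apply: (@uniqP x)|apply: (@uniqP y)].
have symT i j x y : of_type P i j x y = of_type P j i y x.
  by rewrite /of_type andbC.
have exT x y : exists i j, of_type P i j x y.
  have [i xi] := cover x; have [j yj] := cover y.
  by exists i, j; rewrite /of_type xi yj.
have undC x y : undirected M x y = undirected M y x.
  rewrite /undirected [X in _ && X]andbC; congr (_ && _).
  by apply/idP/idP; apply: adj_sym.
pose Q d x y := exists i j, of_type P i j x y /\ diff_mod i j d.
have QE d i j x y : of_type P i j x y -> Q d x y -> diff_mod i j d.
  by move=> t [i' [j' [t' h]]]; have [-> ->] := uniqT _ _ _ _ _ _ t t'.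
have Q12 x y : Q 1 x y -> ~ Q 2 x y.
  move=> h1 h2; have [i [j t]] := exT x y.
  by have [/(_ (QE _ _ _ _ _ t h1))] := diff_mod_absurd i j k3; case/(_ (QE _ _ _ _ _ t h2)).
have Q11 x y : Q 1 x y -> ~ Q 1 y x.
  move=> h1 h2; have [i [j t]] := exT x y.
  have t' : of_type P j i y x by rewrite -symT.
  by have [_ /(_ (QE _ _ _ _ _ t h1))] := diff_mod_absurd i j k3; case/(_ (QE _ _ _ _ _ t' h2)).
pose A x y := [|| undirected M x y && `[< Q 1 y x >],
   [&& arc M x y, ~~ `[< Q 1 x y >] & ~~ `[< Q 2 x y >]]
 | arc M y x && `[< Q 2 y x >] ].
have undN x y : undirected M x y -> (arc M x y = false) * (arc M y x = false).
  by move=> /and3P[_ /negbTE-> /negbTE->].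
have arcN x y : arc M x y -> (arc M y x = false) * (undirected M x y = false) *
    (undirected M y x = false).
  by move=> h; rewrite [undirected M y x]undC /undirected h (negbTE (arc_asym h)) andbF.
have Aadj x y : A x y -> adj (underlying M) x y.
  move=> /or3P[/andP[/and3P[]]//|/andP[/arc_adj]//|/andP[/arc_adj/adj_sym]//].
have Aasym x y : A x y -> ~~ A y x.
  rewrite /A => /or3P[/andP[u /asboolP q]|/and3P[a /negbTE n1 /negbTE n2]|/andP[a q]].
  - rewrite -undC u !(undN _ _ u) /= orbF.
    by apply/negP => /asboolP; apply: Q11.
  - by rewrite !(arcN _ _ a) a n2 andbF.
  - by rewrite !(arcN _ _ a) a q /= andbF.
exists (MixedGraph Aadj Aasym); split => //=.
- move=> i j x y u t d; rewrite /A u; apply/orP; left; apply/asboolP.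
  by exists j, i; rewrite -symT.
- move=> i j x y a t d; rewrite /undirected /= (arc_adj a) /A !(arcN _ _ a) a /=.
  have q1 : Q 1 x y by exists i, j.
  have -> : `[< Q 1 x y >] by apply/asboolP.
  by rewrite /=; apply/asboolPn; apply: Q12.
- move=> i j x y a t d; rewrite /A a; apply/or3P/Or33/asboolP.
  by exists i, j.
- move=> i j x y u t n1 n2; rewrite /undirected /= /A -[undirected M y x]undC u.
  rewrite !(undN _ _ u) /= !orbF; move: (u) => /and3P[-> _ _] /=.
  apply/andP; split; apply/asboolPn => q.
  + by apply: n1; apply: QE q; rewrite -symT.
  + by apply: n2; apply: QE q.
- move=> i j x y a t n1 n2; rewrite /A a; apply/or3P/Or32 => /=.
  by apply/andP; split; apply/asboolPn => q; [apply: n1|apply: n2]; apply: QE q.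
Qed.

(* Main.v *)
From mathcomp Require Import all_boot all_order all_algebra.
From mathcomp Require Import all_classical all_reals all_analysis.
From mathcomp Require Import complex.
Require Import Defs.

Set Implicit Arguments.
Unset Strict Implicit.
Unset Printing Implicit Defensive.

Import GRing.Theory Num.Theory.

Local Open Scope ring_scope.

(** Let [c x] be the index of the part containing [x] and let [D] be the diagonal
    matrix with entries [omega ^ c x]. Since [omega] is a [k]-th root of unity,
    each rule of the switching multiplies the [(x, y)] entry of the Hermitian
    adjacency matrix by [omega ^ (c y - c x)]: an undirected edge with
    [c y - c x = 1] goes from [1] to [omega], an arc with [c x - c y = 1] from
    [omega] to [1], and an arc with [c x - c y = 2] from [omega] to [omega^-1].
    Hence the new matrix is the conjugate of the old one by [D]. *)

(** Over the polynomial ring, [D (X - A) = (X - B) D]. Taking determinants and cancelling the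
    nonzero constant [\det D] avoids inverting [D]. *)
Lemma char_poly_similar (F : fieldType) (n : nat) (D A B : 'M[F]_n) :
  \det D != 0 -> D *m A = B *m D -> char_poly A = char_poly B.
Proof.
move=> D0 DAB; pose Dp := map_mx (@polyC F) D.
have Dp0 : \det Dp != 0 by rewrite det_map_mx polyC_eq0.
apply: (mulfI Dp0); rewrite /char_poly -det_mulmx [RHS]mulrC -det_mulmx.
congr (\det _); rewrite /char_poly_mx mulmxBr mulmxBl -!map_mxM /= DAB.
by rewrite mul_mx_scalar mul_scalar_mx.
Qed.

(** De Moivre's formula, from the addition formulas. *)
Lemma complex_trig_expn (R : realType) (t : R) (n : nat) :
  (Complex (cos t) (sin t)) ^+ n = Complex (cos (t *+ n)) (sin (t *+ n)).
Proof.
elim: n => [|n IHn]; first by rewrite expr0 mulr0n cos0 sin0.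
rewrite exprS IHn mulrS cosD sinD; apply/eqP; rewrite eq_complex /=.
by rewrite !eqxx addrC [cos t * _]mulrC eqxx.
Qed.

Section Omega.
Variables (R : realType) (k : nat).
Local Notation w := (omega R k).

Lemma omega_expk : (0 < k)%N -> w ^+ k = 1.
Proof.
move=> k0; rewrite complex_trig_expn -[_ *+ k]mulr_natr divfK ?pnatr_eq0 -?lt0n//.
by rewrite mulr_natl cos2pi sin2pi.
Qed.

Lemma omega_mul_conj : w * conjc w = 1.
Proof.
apply/eqP; rewrite eq_complex /= mulrN opprK -!expr2 cos2Dsin2 eqxx /=.
by rewrite mulrN mulrC addNr.
Qed.

Lemma omega_neq0 : w != 0.
Proof.
by apply/eqP => w0; have /esym/eqP := omega_mul_conj; rewrite w0 mul0r oner_eq0.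
Qed.

(** With conjugates written as powers, every nonzero matrix entry is an integer power of [w], and
    switching only shifts exponents. *)
Lemma conj_omega : conjc w = w ^ (-1).
Proof.
by apply: (mulfI omega_neq0); rewrite omega_mul_conj exprN1 divff ?omega_neq0.
Qed.

Lemma conj_omega_expz (d : int) : conjc (w ^ d) = w ^ (- d).
Proof. by rewrite -mulN1r -exprz_exp -conj_omega; apply: fmorphXz. Qed.

Lemma omega_expz_diff (i j : 'I_k) (d : int) :
  diff_mod i j d -> w ^ (i%:Z - j%:Z) = w ^ d.
Proof.
move=> /eqP; rewrite eqz_mod_dvd => /dvdzP[q /eqP]; rewrite subr_eq => /eqP ->.
(* The index [i] itself witnesses that [k] is positive. *)
have k0 : (0 < k)%N := leq_ltn_trans (leq0n i) (ltn_ord i).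
rewrite expfzDr ?omega_neq0// [q * _]mulrC -exprz_exp -exprnP omega_expk//.
by rewrite exp1rz mul1r.
Qed.

End Omega.

Lemma diff_modN (k : nat) (i j : 'I_k) (d : int) :
  diff_mod i j d -> diff_mod j i (- d).
Proof.
by move=> /eqP; rewrite eqz_mod_dvd -rpredN => h; apply/eqP;
  rewrite eqz_mod_dvd; move: h; rewrite !opprB opprK addrC.
Qed.

Lemma undirectedC (V : finType) (M : mixed_graph V) (x y : V) :
  undirected M x y = undirected M y x.
Proof.
by rewrite /undirected [X in _ && X]andbC; congr (_ && _);
  apply/idP/idP; apply: adj_sym.
Qed.

(** Indexing by vertices keeps the enumeration of [V] out of the case analysis. *)
Definition hermitian_entry (R : realType) (k : nat) (V : finType)
    (M : mixed_graph V) (u v : V) : R[i] :=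
  if arc M u v then omega R k
  else if arc M v u then conjc (omega R k)
  else if undirected M u v then 1 else 0.

Section HermitianEntry.
Variables (R : realType) (k : nat) (V : finType) (M : mixed_graph V).
Local Notation w := (omega R k).
Local Notation h := (hermitian_entry R k M).

Lemma hermitian_entry_arc (x y : V) : arc M x y -> h x y = w ^ 1.
Proof. by rewrite /hermitian_entry expr1z => ->. Qed.

Lemma hermitian_entry_und (x y : V) : undirected M x y -> h x y = w ^ 0.
Proof.
by rewrite /hermitian_entry => u; case/and3P: (u) => _ /negbTE-> /negbTE->; rewrite u.
Qed.

Lemma hermitian_entry_conj (x y : V) : h y x = conjc (h x y).
Proof.
rewrite /hermitian_entry undirectedC.
case: ifP => [yx|_]; first by rewrite (negbTE (arc_asym yx)) conjcK.
by case: ifP => _ //; case: ifP => _; rewrite ?conjc1 ?conjc0.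
Qed.

Lemma hermitian_entry_rev (x y : V) : arc M y x -> h x y = w ^ (-1).
Proof.
by move=> yx; rewrite hermitian_entry_conj hermitian_entry_arc// expr1z conj_omega.
Qed.

Lemma hermitian_entry_nonadj (x y : V) : ~~ adj (underlying M) x y -> h x y = 0.
Proof.
rewrite /hermitian_entry /undirected => nxy; rewrite (negbTE nxy) /=.
case: ifP => [/arc_adj|_]; first by rewrite (negbTE nxy).
by case: ifP => // /arc_adj/adj_sym; rewrite (negbTE nxy).
Qed.

End HermitianEntry.

Section Switching.
Variables (R : realType) (k : nat) (V : finType).
Variables (M M' : mixed_graph V) (P : 'I_k -> {set V}).
Hypotheses (admP : admissible M P) (switchM : three_way_switching M P M').
Variable c : V -> 'I_k.
Hypothesis of_typeE : forall i j x y, of_type P i j x y -> i = c x /\ j = c y.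
Local Notation w := (omega R k).
Local Notation h := (hermitian_entry R k).

Lemma switching_und (x y : V) : undirected M x y ->
  h M' x y = h M x y * w ^ ((c y)%:Z - (c x)%:Z).
Proof.
move=> u; have [i [j [t]]] := admP.1 _ _ u; have [-> ->] := of_typeE t.
have {t} [t1 t2] : of_type P (c x) (c y) x y /\ of_type P (c y) (c x) y x.
  by have [<- <-] := of_typeE t; rewrite {2}/of_type andbC.
rewrite (hermitian_entry_und _ _ u) mul1r => adm.
have [d|n1] := pselect (diff_mod (c y) (c x) 1).
  by rewrite (omega_expz_diff R d) hermitian_entry_arc// (switch_und_to_arc switchM u t1).
have [d|n2] := pselect (diff_mod (c x) (c y) 1).
  rewrite (omega_expz_diff R (diff_modN d)) hermitian_entry_rev//.
  by apply: (switch_und_to_arc switchM _ t2); rewrite 1?undirectedC.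
(* The differences 1 and -1 are already excluded, so only 0 survives. *)
case: adm => [d|//|/diff_modN//].
by rewrite (omega_expz_diff R d) hermitian_entry_und// (switch_und switchM u t1).
Qed.

Lemma switching_arc (x y : V) : arc M x y ->
  h M' x y = h M x y * w ^ ((c y)%:Z - (c x)%:Z).
Proof.
move=> a; have [i [j [t]]] := admP.2 _ _ a.
have [ei ej] := of_typeE t; rewrite {}ei {}ej in t * => adm.
rewrite (hermitian_entry_arc _ _ a) -expfzDr ?omega_neq0//.
have [d|n1] := pselect (diff_mod (c x) (c y) 1).
  rewrite expfzDr ?omega_neq0// (omega_expz_diff R (diff_modN d)).
  rewrite -expfzDr ?omega_neq0// subrr hermitian_entry_und//.
  exact: (switch_arc_to_und switchM a t).
(* Here [w * w ^ (-2) = w ^ (-1)], the entry of a reversed arc. *)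
have [d|n2] := pselect (diff_mod (c x) (c y) 2).
  rewrite expfzDr ?omega_neq0// (omega_expz_diff R (diff_modN d)).
  by rewrite -expfzDr ?omega_neq0// hermitian_entry_rev// (switch_reverse switchM a t).
case: adm => // /diff_modN; rewrite oppr0 => d.
rewrite expfzDr ?omega_neq0// (omega_expz_diff R d) mulr1 hermitian_entry_arc//.
exact: (switch_arc switchM a t).
Qed.

Lemma switching_entry (x y : V) :
  h M' x y = h M x y * w ^ ((c y)%:Z - (c x)%:Z).
Proof.
have [/switching_arc//|nxy] := boolP (arc M x y).
(* Both matrices are Hermitian, and conjugation negates the exponent [c x - c y], so this case
   follows from that of an arc from [x] to [y]. *)
have [/switching_arc e|nyx] := boolP (arc M y x).
  rewrite hermitian_entry_conj e rmorphM /= -hermitian_entry_conj.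
  by rewrite conj_omega_expz opprB.
have [/switching_und//|] := boolP (undirected M x y).
rewrite /undirected nxy nyx !andbT => n.
by rewrite !hermitian_entry_nonadj ?mul0r// (switch_underlying switchM).
Qed.

End Switching.

Lemma hermitian_adjE (R : realType) (k : nat) (V : finType) (M : mixed_graph V)
    (a b : 'I_#|V|) :
  hermitian_adj R k M a b = hermitian_entry R k M (enum_val a) (enum_val b).
Proof. by rewrite mxE. Qed.

Lemma char_poly_switching (R : realType) (k : nat) (V : finType)
    (M M' : mixed_graph V) (P : 'I_k -> {set V}) :
  vertex_partition P -> admissible M P -> three_way_switching M P M' ->
  char_poly (hermitian_adj R k M') = char_poly (hermitian_adj R k M).
Proof.
move=> [cover disj] admP switchM.
(* Covering provides a part for each vertex; disjointness makes its index unique. *)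
pose c x := xchoose (cover x).
have cP x i : x \in P i -> i = c x.
  move=> xi; apply/eqP/negPn/negP => /disj /pred0P /(_ x) /=.
  by rewrite xi (xchooseP (cover x)).
have of_typeE i j x y : of_type P i j x y -> i = c x /\ j = c y.
  by move=> /andP[/cP <- /cP <-].
pose D := \row_(a < #|V|) omega R k ^ (c (enum_val a))%:Z.
apply: (@char_poly_similar _ _ (diag_mx D)).
  by rewrite det_diag; apply/prodf_neq0 => a _; rewrite mxE expfz_neq0 ?omega_neq0.
apply/matrixP => a b; rewrite mul_diag_mx mul_mx_diag mxE [RHS]mxE.
rewrite !hermitian_adjE (switching_entry R admP switchM of_typeE).
rewrite [D 0 a]mxE [D 0 b]mxE.
by rewrite mulrCA -expfzDr ?omega_neq0// subrKC.
Qed.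

Theorem theorem2p5 (R : realType) (k : nat) (hk : (3 <= k)%N) (V : finType)
    (M M' : mixed_graph V) (P : 'I_k -> {set V})
    (partP : vertex_partition P) (admP : admissible M P)
    (switchM : three_way_switching M P M') :
  cospectral R k M' M.
Proof.
have E := char_poly_switching R partP admP switchM.
(* Eigenvalues are the roots of the characteristic polynomial, so [E] settles both the spectrum and
   the multiplicities. *)
split=> a; first by rewrite !eigenvalue_root_char E.
by rewrite E => _.
Qed.
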